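(* Let $\mathcal{C}',\mathcal{C},\mathcal{C}''$ be triangulated categories and suppose there is a recollement of $\mathcal{C}$ relative to $\mathcal{C}'$ and $\mathcal{C}''$ given by the six exact functors $i^*, i^!:\mathcal{C}\to\mathcal{C}'$, $i_*=i_!:\mathcal{C}'\to\mathcal{C}$, $j^!=j^*:\mathcal{C}\to\mathcal{C}''$, $j_!, j_*:\mathcal{C}''\to\mathcal{C}$. Assume that $j_*$ admits a right adjoint $j^\sharp:\mathcal{C}\to\mathcal{C}''$. Let $T'$ be a tilting object in $\mathcal{C}'$ and $T''$ a tilting object in $\mathcal{C}''$. Then the following statements are equivalent: (1) $T=i_*(T')\oplus j_*(T'')$ is a tilting object in $\mathcal{C}$. (2) $\mathrm{Hom}_{\mathcal{C}''}(T'', j^\sharp i_*(T')[n])=0$ for all integers $n\neq 0$. (3) $\mathrm{Hom}_{\mathcal{C}'}(i^*j_*(T''), T'[n])=0$ for all integers $n\neq 0$.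
   Context: Recollement: the six functors are exact (triangle) functors such that (a) $(i^*,i_*,i^!)$ and $(j_!,j^*,j_* )$ are adjoint triples (each consecutive pair is an adjoint pair, left adjoint written first); (b) $i_*, j_*, j_!$ are fully faithful; (c) $i^!\circ j_*=0$ (hence also $j^*\circ i_*=0$ and $i^*\circ j_!=0$); (d) for each $Z\in\mathcal{C}$ the units and counits of the adjunctions yield triangles $i_*i^!Z\to Z\to j_*j^*Z\to i_*i^!Z[1]$ and $j_!j^*Z\to Z\to i_*i^*Z\to j_!j^*Z[1]$. Tilting object: an object $T$ of a triangulated category $\mathcal{C}$ is tilting if $\mathrm{Hom}_{\mathcal{C}}(T,T[n])=0$ for all integers $n\neq 0$ and $T$ generates $\mathcal{C}$ as a thick subcategory (i.e. the smallest thick subcategory of $\mathcal{C}$ containing $T$ is $\mathcal{C}$). *)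

(* Defs.v *)
(* Triangulated categories over MathComp: hom-groups are [zmodType]s. *)
From mathcomp Require Import all_boot all_order all_algebra.

Set Implicit Arguments.
Unset Strict Implicit.
Unset Printing Implicit Defensive.

Import GRing.Theory.
Local Open Scope ring_scope.

Declare Scope cat_scope.
Delimit Scope cat_scope with cat.
Local Open Scope cat_scope.

Reserved Notation "X ~> Y" (at level 90, Y at level 90, right associativity).
Reserved Notation "g ∘ f" (at level 40, left associativity).
Reserved Notation "X ⊞ Y" (at level 50, left associativity).
Reserved Notation "X ⟦ n ⟧" (at level 1, left associativity, format "X ⟦ n ⟧").

Record preadditive := Preadditive {
  obj :> Type;
  hom : obj -> obj -> zmodType;
  idm : forall X, hom X X;
  comp : forall X Y Z, hom Y Z -> hom X Y -> hom X Z;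
  compA : forall W X Y Z (h : hom Y Z) (g : hom X Y) (f : hom W X),
    comp h (comp g f) = comp (comp h g) f;
  comp1m : forall X Y (f : hom X Y), comp (idm Y) f = f;
  compm1 : forall X Y (f : hom X Y), comp f (idm X) = f;
  compDl : forall X Y Z (g g' : hom Y Z) (f : hom X Y),
    comp (g + g') f = comp g f + comp g' f;
  compDr : forall X Y Z (g : hom Y Z) (f f' : hom X Y),
    comp g (f + f') = comp g f + comp g f'
}.
Arguments hom {_} _ _.
Arguments idm {_} X.
Arguments comp {_ X Y Z} g f.

Notation "X ~> Y" := (hom X Y) : cat_scope.
Notation "g ∘ f" := (comp g f) : cat_scope.

Definition is_iso (C : preadditive) (X Y : C) (f : X ~> Y) : Prop :=
  exists g : Y ~> X, g ∘ f = idm X /\ f ∘ g = idm Y.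

Definition is_zero (C : preadditive) (Z : C) : Prop :=
  (forall X (f : X ~> Z), f = 0) /\ (forall X (f : Z ~> X), f = 0).

Record additive_cat := AdditiveCat {
  ac_base :> preadditive;
  zobj : ac_base;
  zobjP : is_zero zobj;
  biprod : ac_base -> ac_base -> ac_base;
  inL : forall X Y, X ~> biprod X Y;
  inR : forall X Y, Y ~> biprod X Y;
  prL : forall X Y, biprod X Y ~> X;
  prR : forall X Y, biprod X Y ~> Y;
  prL_inL : forall X Y, prL X Y ∘ inL X Y = idm X;
  prR_inR : forall X Y, prR X Y ∘ inR X Y = idm Y;
  prL_inR : forall X Y, prL X Y ∘ inR X Y = 0;
  prR_inL : forall X Y, prR X Y ∘ inL X Y = 0;
  biprod_id : forall X Y,
    inL X Y ∘ prL X Y + inR X Y ∘ prR X Y = idm (biprod X Y)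
}.
Arguments zobj {_}.
Arguments biprod {_} X Y.

Notation "X ⊞ Y" := (biprod X Y) : cat_scope.

Record functor (C D : preadditive) := Functor {
  fobj :> C -> D;
  fmap : forall X Y, (X ~> Y) -> (fobj X ~> fobj Y);
  fmap_id : forall X, fmap (idm X) = idm (fobj X);
  fmap_comp : forall X Y Z (g : Y ~> Z) (f : X ~> Y),
    fmap (g ∘ f) = fmap g ∘ fmap f
}.
Arguments fmap {C D} F {X Y} f : rename.

Definition additive_functor (C D : preadditive) (F : functor C D) : Prop :=
  forall (X Y : C) (f g : X ~> Y), fmap F (f + g) = fmap F f + fmap F g.

Definition fully_faithful (C D : preadditive) (F : functor C D) : Prop :=
  forall X Y : C, bijective (fun f : X ~> Y => fmap F f).

(* Natural transformations and isomorphisms are stated between families of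
   objects with explicit actions on morphisms, so that F and G may be
   composites of functors. *)
Definition natural (C D : preadditive) (F G : C -> D)
    (mF : forall X Y, (X ~> Y) -> (F X ~> F Y))
    (mG : forall X Y, (X ~> Y) -> (G X ~> G Y))
    (t : forall X, F X ~> G X) : Prop :=
  forall (X Y : C) (f : X ~> Y), t Y ∘ mF X Y f = mG X Y f ∘ t X.

(* L is left adjoint to R. *)
Record adjunction (C D : preadditive) (L : functor C D) (R : functor D C) :=
  Adjunction {
  unit : forall X : C, X ~> R (L X);
  counit : forall Y : D, L (R Y) ~> Y;
  unit_nat : natural (fun _ _ f => f) (fun _ _ f => fmap R (fmap L f)) unit;
  counit_nat : natural (fun _ _ f => fmap L (fmap R f)) (fun _ _ f => f) counit;
  adj_triangleL : forall X : C, counit (L X) ∘ fmap L (unit X) = idm (L X);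
  adj_triangleR : forall Y : D, fmap R (counit Y) ∘ unit (R Y) = idm (R Y)
}.
Arguments unit {C D L R} a X : rename.
Arguments counit {C D L R} a Y : rename.

(* The shift is an additive autoequivalence, with a chosen quasi-inverse
   [unshift]; [dist f g h] says that X -f-> Y -g-> Z -h-> X[1] is a
   distinguished triangle. *)
Record triangulated := Triangulated {
  tr_base :> additive_cat;
  shift : functor tr_base tr_base;
  unshift : functor tr_base tr_base;
  shift_additive : additive_functor shift;
  shiftK : forall X, X ~> unshift (shift X);
  shiftK_nat :
    natural (fun _ _ f => f) (fun _ _ f => fmap unshift (fmap shift f)) shiftK;
  shiftK_iso : forall X, is_iso (shiftK X);
  unshiftK : forall X, shift (unshift X) ~> X;
  unshiftK_nat :
    natural (fun _ _ f => fmap shift (fmap unshift f)) (fun _ _ f => f) unshiftK;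
  unshiftK_iso : forall X, is_iso (unshiftK X);
  dist : forall X Y Z, (X ~> Y) -> (Y ~> Z) -> (Z ~> shift X) -> Prop;
  dist_iso : forall X Y Z X' Y' Z'
      (f : X ~> Y) (g : Y ~> Z) (h : Z ~> shift X)
      (f' : X' ~> Y') (g' : Y' ~> Z') (h' : Z' ~> shift X')
      (a : X ~> X') (b : Y ~> Y') (c : Z ~> Z'),
    is_iso a -> is_iso b -> is_iso c ->
    b ∘ f = f' ∘ a -> c ∘ g = g' ∘ b -> fmap shift a ∘ h = h' ∘ c ->
    dist f g h -> dist f' g' h';
  dist_id : forall X, dist (idm X) (0 : X ~> zobj) (0 : zobj ~> shift X);
  dist_cone : forall X Y (f : X ~> Y),
    exists (Z : tr_base) (g : Y ~> Z) (h : Z ~> shift X), dist f g h;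
  dist_rot : forall X Y Z (f : X ~> Y) (g : Y ~> Z) (h : Z ~> shift X),
    dist f g h <-> dist g h (- fmap shift f);
  dist_mor : forall X Y Z X' Y' Z'
      (f : X ~> Y) (g : Y ~> Z) (h : Z ~> shift X)
      (f' : X' ~> Y') (g' : Y' ~> Z') (h' : Z' ~> shift X')
      (a : X ~> X') (b : Y ~> Y'),
    dist f g h -> dist f' g' h' -> b ∘ f = f' ∘ a ->
    exists c : Z ~> Z', c ∘ g = g' ∘ b /\ fmap shift a ∘ h = h' ∘ c;
  (* Octahedral axiom: Cf, Cg, Cgf are cones of f, g and g ∘ f. *)
  dist_oct : forall X Y Z Cf Cg Cgf (f : X ~> Y) (g : Y ~> Z)
      (f1 : Y ~> Cf) (f2 : Cf ~> shift X)
      (g1 : Z ~> Cg) (g2 : Cg ~> shift Y)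
      (h1 : Z ~> Cgf) (h2 : Cgf ~> shift X),
    dist f f1 f2 -> dist g g1 g2 -> dist (g ∘ f) h1 h2 ->
    exists (u : Cf ~> Cgf) (v : Cgf ~> Cg),
      [/\ dist u v (fmap shift f1 ∘ g2),
          u ∘ f1 = h1 ∘ g, h2 ∘ u = f2,
          v ∘ h1 = g1 & g2 ∘ v = fmap shift f ∘ h2]
}.
Arguments shift {_}.
Arguments unshift {_}.
Arguments dist {_ X Y Z} f g h.

Definition shiftn (C : triangulated) (X : C) (n : int) : C :=
  match n with
  | Posz k => iter k (@shift C) X
  | Negz k => iter k.+1 (@unshift C) X
  end.

Notation "X ⟦ n ⟧" := (shiftn X n) : cat_scope.

Record exact_functor (C D : triangulated) := ExactFunctor {
  ex_functor :> functor C D;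
  ex_additive : additive_functor ex_functor;
  ex_shift : forall X : C, ex_functor (shift X) ~> shift (ex_functor X);
  ex_shift_nat : natural (fun _ _ f => fmap ex_functor (fmap shift f))
                         (fun _ _ f => fmap shift (fmap ex_functor f)) ex_shift;
  ex_shift_iso : forall X, is_iso (ex_shift X);
  ex_dist : forall (X Y Z : C) (f : X ~> Y) (g : Y ~> Z) (h : Z ~> shift X),
    dist f g h ->
    dist (fmap ex_functor f) (fmap ex_functor g) (ex_shift X ∘ fmap ex_functor h)
}.

(* Full subcategories are given by predicates on objects. *)
Record thick (C : triangulated) (P : C -> Prop) : Prop := Thick {
  thick_zero : P zobj;
  thick_iso : forall (X Y : C) (f : X ~> Y), is_iso f -> P X -> P Y;
  thick_shift : forall X : C, P X -> P (shift X);
  thick_unshift : forall X : C, P X -> P (unshift X);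
  thick_cone : forall (X Y Z : C) (f : X ~> Y) (g : Y ~> Z) (h : Z ~> shift X),
    dist f g h -> P X -> P Y -> P Z;
  thick_summand : forall X Y : C, P (X ⊞ Y) -> P X
}.

Definition thick_closure (C : triangulated) (T : C) : C -> Prop :=
  fun X => forall P : C -> Prop, thick P -> P T -> P X.

Definition tilting (C : triangulated) (T : C) : Prop :=
  (forall n : int, n <> 0 -> forall f : T ~> T⟦n⟧, f = 0) /\
  (forall X : C, thick_closure T X).

(* iUpStar = i^*, iLoStar = i_*, iUpShriek = i^!,
   jLoShriek = j_!, jUpStar = j^*, jLoStar = j_*. *)
Record recollement (C' C C'' : triangulated) := Recollement {
  iUpStar : exact_functor C C';
  iLoStar : exact_functor C' C;
  iUpShriek : exact_functor C C';
  jLoShriek : exact_functor C'' C;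
  jUpStar : exact_functor C C'';
  jLoStar : exact_functor C'' C;
  iUpStar_iLoStar : adjunction iUpStar iLoStar;
  iLoStar_iUpShriek : adjunction iLoStar iUpShriek;
  jLoShriek_jUpStar : adjunction jLoShriek jUpStar;
  jUpStar_jLoStar : adjunction jUpStar jLoStar;
  iLoStar_ff : fully_faithful iLoStar;
  jLoStar_ff : fully_faithful jLoStar;
  jLoShriek_ff : fully_faithful jLoShriek;
  iUpShriek_jLoStar : forall Y : C'', is_zero (iUpShriek (jLoStar Y));
  rec_triangle_star : forall Z : C,
    exists d : jLoStar (jUpStar Z) ~> shift (iLoStar (iUpShriek Z)),
      dist (counit iLoStar_iUpShriek Z) (unit jUpStar_jLoStar Z) d;
  rec_triangle_shriek : forall Z : C,
    exists d : iLoStar (iUpStar Z) ~> shift (jLoShriek (jUpStar Z)),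
      dist (counit jLoShriek_jUpStar Z) (unit iUpStar_iLoStar Z) d
}.

(* Main.v *)
(** Hom(T, T[n]) splits into four summands. Those from i_*T' to itself and from
    j_*T'' to itself vanish because i_* and j_* are fully faithful, the one from
    i_*T' to j_*T'' because i^! j_* = 0, and the one from j_*T'' to i_*T' is, by
    adjunction, the group in (2) and also the group in (3). Generation is
    automatic: the preimage of a thick subcategory under an exact functor is
    thick, so a thick subcategory containing T contains the images of i_* and
    j_*, hence every Z by the triangle i_*i^!Z -> Z -> j_*j^*Z -> . *)
Require Import Defs.
From mathcomp Require Import all_boot all_order all_algebra.
From Corelib Require Import Setoid.
Import GRing.Theory.

Set Implicit Arguments.
Unset Strict Implicit.
Unset Printing Implicit Defensive.

Local Open Scope ring_scope.
Local Open Scope cat_scope.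

(* [compA] would otherwise denote associativity of function composition. *)
Local Notation compA := Defs.compA.

(** * Vanishing of hom-groups in preadditive categories *)

Definition isomorphic {C : preadditive} (X Y : C) : Prop :=
  exists f : X ~> Y, is_iso f.

(** Unfolds to the exact form of the vanishing conditions in [tilting] and in the theorem, so
    equivalences between [hom_zero] statements apply to them by conversion. *)
Definition hom_zero {C : preadditive} (X Y : C) : Prop :=
  forall f : X ~> Y, f = 0.

Definition faithful {C D : preadditive} (F : functor C D) : Prop :=
  forall X Y : C, injective (fun f : X ~> Y => fmap F f).

Section Preadditive.
Variables C D : preadditive.

Lemma comp0m (X Y Z : C) (f : X ~> Y) : (0 : Y ~> Z) ∘ f = 0.
Proof. by apply: (addrI (0 ∘ f)); rewrite -compDl !addr0. Qed.

Lemma compm0 (X Y Z : C) (f : Y ~> Z) : f ∘ (0 : X ~> Y) = 0.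
Proof. by apply: (addrI (f ∘ 0)); rewrite -compDr !addr0. Qed.

Lemma iso_refl (X : C) : isomorphic X X.
Proof. by exists (idm X), (idm X); rewrite comp1m. Qed.

Lemma iso_sym (X Y : C) : isomorphic X Y -> isomorphic Y X.
Proof. by case=> f [g [gf fg]]; exists g, f. Qed.

Lemma iso_trans (Y X Z : C) :
  isomorphic X Y -> isomorphic Y Z -> isomorphic X Z.
Proof.
case=> f [f' [f'f ff']] [g [g' [g'g gg']]]; exists (g ∘ f), (f' ∘ g'); split.
  by rewrite -compA (compA g' g f) g'g comp1m.
by rewrite -compA (compA f f' g') ff' comp1m.
Qed.

Lemma iso_fmap (F : functor C D) (X Y : C) :
  isomorphic X Y -> isomorphic (F X) (F Y).
Proof.
case=> f [g [gf fg]]; exists (fmap F f), (fmap F g).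
by rewrite -!fmap_comp gf fg !fmap_id.
Qed.

Lemma iso_monic (X Y Z : C) (u : Y ~> Z) (f g : X ~> Y) :
  is_iso u -> u ∘ f = u ∘ g -> f = g.
Proof.
by case=> v [vu _] eq_uf; rewrite -(comp1m f) -(comp1m g) -vu -!compA eq_uf.
Qed.

Lemma iso_epic (X Y Z : C) (u : X ~> Y) (f g : Y ~> Z) :
  is_iso u -> f ∘ u = g ∘ u -> f = g.
Proof.
by case=> v [_ uv] eq_fu; rewrite -(compm1 f) -(compm1 g) -uv !compA eq_fu.
Qed.

Lemma hom_zero_iso (X Y X' Y' : C) : isomorphic X X' -> isomorphic Y Y' ->
  hom_zero X Y <-> hom_zero X' Y'.
Proof.
move=> [u [u' [u'u uu']]] [v [v' [v'v vv']]]; split=> XY0 f.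
  by rewrite -(comp1m f) -(compm1 f) -uu' -vv' !compA -(compA _ f u)
    -(compA v) (XY0 (v' ∘ (f ∘ u))) compm0 comp0m.
by rewrite -(comp1m f) -(compm1 f) -u'u -v'v !compA -(compA _ f u')
  -(compA v') (XY0 (v ∘ (f ∘ u'))) compm0 comp0m.
Qed.

Lemma faithful_hom_zero (F : functor C D) (X Y : C) :
  faithful F -> hom_zero (F X) (F Y) -> hom_zero X Y.
Proof. by move=> injF FXY0 f; apply: injF; rewrite (FXY0 (fmap F 0)). Qed.

Lemma fully_faithful_hom_zero (F : functor C D) (X Y : C) :
  fully_faithful F -> hom_zero X Y -> hom_zero (F X) (F Y).
Proof.
move=> /(_ X Y) [G _ GK] XY0 f.
by rewrite -(GK f) -[RHS]GK (XY0 (G f)) (XY0 (G 0)).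
Qed.

Lemma additive_fmap0 (F : functor C D) (X Y : C) :
  additive_functor F -> fmap F (0 : X ~> Y) = 0.
Proof. by move=> addF; apply: (addrI (fmap F 0)); rewrite -addF !addr0. Qed.

(* The transpose is a bijection of hom-sets, and any bijection, additive or
   not, transports triviality. *)
Lemma adjunction_hom_zero (L : functor C D) (R : functor D C)
    (adj : adjunction L R) (X : C) (Y : D) :
  hom_zero (L X) Y <-> hom_zero X (R Y).
Proof.
have transposeK (f : X ~> R Y) :
    fmap R (counit adj Y ∘ fmap L f) ∘ unit adj X = f.
  have := unit_nat adj f; rewrite fmap_comp -compA => <-.
  by rewrite compA adj_triangleR comp1m.
have untransposeK (g : L X ~> Y) :
    counit adj Y ∘ fmap L (fmap R g ∘ unit adj X) = g.
  have := counit_nat adj g; rewrite fmap_comp compA => ->.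
  by rewrite -compA adj_triangleL compm1.
split=> hom0 f.
  by rewrite -(transposeK f) -[RHS]transposeK (hom0 (_ ∘ fmap L f))
    (hom0 (_ ∘ fmap L 0)).
by rewrite -(untransposeK f) -[RHS]untransposeK (hom0 (fmap R f ∘ _))
  (hom0 (fmap R 0 ∘ _)).
Qed.

End Preadditive.

(** * Biproducts and zero objects *)

Section Additive.
Variable C : additive_cat.

Lemma hom_zero_biprodl (X Y Z : C) :
  hom_zero (X ⊞ Y) Z <-> hom_zero X Z /\ hom_zero Y Z.
Proof.
split=> [XY0|[X0 Y0] f].
  split=> f.
    by rewrite -(compm1 f) -(prL_inL X Y) compA (XY0 (f ∘ _)) comp0m.
  by rewrite -(compm1 f) -(prR_inR X Y) compA (XY0 (f ∘ _)) comp0m.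
by rewrite -(compm1 f) -biprod_id compDr !compA (X0 (f ∘ _)) (Y0 (f ∘ _))
  !comp0m addr0.
Qed.

Lemma hom_zero_biprodr (X Y Z : C) :
  hom_zero Z (X ⊞ Y) <-> hom_zero Z X /\ hom_zero Z Y.
Proof.
split=> [XY0|[X0 Y0] f].
  split=> f.
    by rewrite -(comp1m f) -(prL_inL X Y) -compA (XY0 (_ ∘ f)) compm0.
  by rewrite -(comp1m f) -(prR_inR X Y) -compA (XY0 (_ ∘ f)) compm0.
by rewrite -(comp1m f) -biprod_id compDl -!compA (X0 (_ ∘ f)) (Y0 (_ ∘ f))
  !compm0 addr0.
Qed.

(** Since [biprod] is chosen structure, any other object carrying biproduct data has to be compared
    with it; this serves for swapped summands and for images under additive functors. *)
Lemma biprod_iso (X Y Z : C)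
    (iX : X ~> Z) (iY : Y ~> Z) (pX : Z ~> X) (pY : Z ~> Y) :
    pX ∘ iX = idm X -> pY ∘ iY = idm Y -> pX ∘ iY = 0 -> pY ∘ iX = 0 ->
    iX ∘ pX + iY ∘ pY = idm Z ->
  isomorphic Z (X ⊞ Y).
Proof.
move=> pXiX pYiY pXiY pYiX idZ.
exists (inL X Y ∘ pX + inR X Y ∘ pY), (iX ∘ prL X Y + iY ∘ prR X Y).
split.
  rewrite compDl !compDr -!compA.
  rewrite !(compA (prL X Y)) !(compA (prR X Y)).
  by rewrite prL_inL prR_inR prL_inR prR_inL !comp0m !compm0 !comp1m addr0 add0r.
rewrite compDl !compDr -!compA !(compA pX) !(compA pY).
by rewrite pXiX pXiY pYiX pYiY !comp0m !compm0 !comp1m addr0 add0r biprod_id.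
Qed.

Lemma biprodC (X Y : C) : isomorphic (X ⊞ Y) (Y ⊞ X).
Proof.
apply: (biprod_iso (iX := inR X Y) (iY := inL X Y) (pX := prR X Y)
  (pY := prL X Y)).
- exact: prR_inR.
- exact: prL_inL.
- exact: prR_inL.
- exact: prL_inR.
- by rewrite addrC biprod_id.
Qed.

Lemma iso_zobj (Z : C) : idm Z = 0 -> isomorphic zobj Z.
Proof.
move=> Z0; exists 0, 0; rewrite comp0m Z0 compm0; split=> //.
by rewrite ((zobjP C).1 _ (idm zobj)).
Qed.

End Additive.

Lemma fmap_biprod (C D : additive_cat) (F : functor C D) (X Y : C) :
  additive_functor F -> isomorphic (F (X ⊞ Y)) (F X ⊞ F Y).
Proof.
move=> addF.
apply: (biprod_iso (iX := fmap F (inL X Y)) (iY := fmap F (inR X Y))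
  (pX := fmap F (prL X Y)) (pY := fmap F (prR X Y))); rewrite -!fmap_comp.
- by rewrite prL_inL fmap_id.
- by rewrite prR_inR fmap_id.
- by rewrite prL_inR additive_fmap0.
- by rewrite prR_inL additive_fmap0.
- by rewrite -addF biprod_id fmap_id.
Qed.

(** * Moving shifts across hom-groups *)

Section Shift.
Variable C : triangulated.

Lemma shift_unshift (X : C) : isomorphic (shift (unshift X)) X.
Proof. by exists (unshiftK X); apply: unshiftK_iso. Qed.

Lemma unshift_shift (X : C) : isomorphic (unshift (shift X)) X.
Proof. by apply: iso_sym; exists (shiftK X); apply: shiftK_iso. Qed.

(** By naturality, [shiftK Y ∘ f] depends on [f] only through [fmap shift f], and [shiftK Y] can be
    cancelled. *)
Lemma shift_faithful : faithful (@shift C).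
Proof.
move=> X Y f g /= eq_fg; apply: iso_monic (shiftK_iso Y) _.
by have /= -> := shiftK_nat f; rewrite eq_fg -(shiftK_nat g).
Qed.

Lemma unshift_faithful : faithful (@unshift C).
Proof.
move=> X Y f g /= eq_fg; apply: iso_epic (unshiftK_iso X) _.
by have /= <- := unshiftK_nat f; rewrite eq_fg (unshiftK_nat g).
Qed.

(** Faithfulness of [unshift] replaces fullness of [shift] in the converse: after unshifting, both
    objects are isomorphic to the original ones. *)
Lemma hom_zero_shift (X Y : C) :
  hom_zero (shift X) (shift Y) <-> hom_zero X Y.
Proof.
split; first exact/faithful_hom_zero/shift_faithful.
move=> XY0; apply/(faithful_hom_zero unshift_faithful).
by apply/(hom_zero_iso (unshift_shift X) (unshift_shift Y)).
Qed.

Lemma hom_zero_shiftr (X Y : C) :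
  hom_zero X (shift Y) <-> hom_zero (unshift X) Y.
Proof.
rewrite -(hom_zero_shift (unshift X)).
exact: hom_zero_iso (iso_sym (shift_unshift X)) (iso_refl _).
Qed.

Lemma hom_zero_unshiftr (X Y : C) :
  hom_zero X (unshift Y) <-> hom_zero (shift X) Y.
Proof.
rewrite -(hom_zero_shift X).
exact: hom_zero_iso (iso_refl _) (shift_unshift Y).
Qed.

(** Frees the second argument of its shift, so that an adjunction or a biproduct decomposition can
    be applied there directly. *)
Lemma hom_zero_shiftn (X Y : C) (n : int) :
  hom_zero X Y⟦n⟧ <-> hom_zero X⟦- n⟧ Y.
Proof.
have shifts k Z : hom_zero Z (iter k shift Y) <-> hom_zero (iter k unshift Z) Y.
  (* The innermost [unshift] is split off, so the induction hypothesis is used at [unshift Z]; hence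
     [Z] is generalized. *)
  elim: k Z => //= k IHk Z; rewrite -[unshift _]/(iter k.+1 unshift Z) iterSr.
  by rewrite hom_zero_shiftr IHk.
have unshifts k Z :
    hom_zero Z (iter k unshift Y) <-> hom_zero (iter k shift Z) Y.
  elim: k Z => //= k IHk Z; rewrite -[shift _]/(iter k.+1 shift Z) iterSr.
  by rewrite hom_zero_unshiftr IHk.
(* As [Negz k] is $-(k+1)$, negation exchanges [Posz k.+1] and [Negz k], and both use [k.+1]
   iterations. *)
case: n => [[|k]|k] //; first exact: (shifts k.+1).
exact: (unshifts k.+1).
Qed.

End Shift.

(** * Exact functors, shifts and thick subcategories *)

Section Exact.
Variables (C D : triangulated) (F : exact_functor C D).

Lemma exact_shift (X : C) : isomorphic (F (shift X)) (shift (F X)).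
Proof. by exists (ex_shift F X); apply: ex_shift_iso. Qed.

Lemma exact_unshift (X : C) : isomorphic (F (unshift X)) (unshift (F X)).
Proof.
apply: (iso_trans (Y := unshift (shift (F (unshift X))))).
  exact/iso_sym/unshift_shift.
apply: iso_fmap; apply: (iso_trans (Y := F (shift (unshift X)))).
  exact/iso_sym/exact_shift.
exact/iso_fmap/shift_unshift.
Qed.

Lemma exact_shiftn (X : C) (n : int) : isomorphic (F X⟦n⟧) (F X)⟦n⟧.
Proof.
have iter_iso (sC : functor C C) (sD : functor D D) k :
    (forall Y, isomorphic (F (sC Y)) (sD (F Y))) ->
    isomorphic (F (iter k sC X)) (iter k sD (F X)).
  move=> Fs; elim: k => [|k IHk] /=; first exact: iso_refl.
  exact: iso_trans (Fs _) (iso_fmap sD IHk).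
case: n => k.
  exact/iter_iso/exact_shift.
exact/(iter_iso _ _ k.+1)/exact_unshift.
Qed.

Lemma thick_preim (P : D -> Prop) : thick P -> thick (fun X => P (F X)).
Proof.
move=> thP; have PE Y Z : isomorphic Y Z -> P Y -> P Z.
  by case=> f /(thick_iso thP); apply.
split.
- apply: PE (thick_zero thP); apply: iso_zobj.
  rewrite -fmap_id ((zobjP C).1 _ (idm zobj)) additive_fmap0 //.
  exact: ex_additive.
- by move=> X Y f iso_f; apply: PE; apply: iso_fmap; exists f.
- by move=> X /(thick_shift thP); apply/PE/iso_sym/exact_shift.
- by move=> X /(thick_unshift thP); apply/PE/iso_sym/exact_unshift.
- by move=> X Y Z f g h /(ex_dist F) /(thick_cone thP).
- move=> X Y PXY; apply: (thick_summand thP (Y := F Y)).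
  exact: PE (fmap_biprod _ _ (ex_additive F)) PXY.
Qed.

Lemma exact_hom_zero (X Y : C) (n : int) : fully_faithful F ->
  hom_zero X Y⟦n⟧ -> hom_zero (F X) (F Y)⟦n⟧.
Proof.
move=> ffF XY0; apply/(hom_zero_iso (iso_refl _) (exact_shiftn Y n)).
exact: fully_faithful_hom_zero.
Qed.

End Exact.

(** [thick_cone] only reaches the third vertex. Two rotations exhibit $Y[1]$ as a cone of $Z \to
    X[1]$, and unshifting recovers $Y$. *)
Lemma thick_middle (C : triangulated) (P : C -> Prop) (X Y Z : C)
    (f : X ~> Y) (g : Y ~> Z) (h : Z ~> shift X) :
  thick P -> dist f g h -> P X -> P Z -> P Y.
Proof.
move=> thP /dist_rot /dist_rot tri PX PZ.
have [u isou] := unshift_shift Y.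
apply: (thick_iso thP isou); apply: (thick_unshift thP).
exact: (thick_cone thP tri PZ (thick_shift thP PX)).
Qed.

(** * Hom-vanishing and generation in a recollement *)

Section Recollement.
Context {C' C C'' : triangulated} (R : recollement C' C C'').

Lemma hom_zero_iLoStar_jLoStar (X : C') (Y : C'') (n : int) :
  hom_zero (iLoStar R X) (jLoStar R Y)⟦n⟧.
Proof.
(* The shift is absorbed into the argument of $j_*$, so that $i^! j_* = 0$ applies at $Y[n]$. *)
apply/(hom_zero_iso (iso_refl _) (exact_shiftn _ Y n)).
apply/(adjunction_hom_zero (iLoStar_iUpShriek R)).
by move=> f; apply: (iUpShriek_jLoStar R _).1.
Qed.

Lemma hom_zero_iUpStar (X : C) (Y : C') (n : int) :
  hom_zero X (iLoStar R Y)⟦n⟧ <-> hom_zero (iUpStar R X) Y⟦n⟧.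
Proof.
rewrite (adjunction_hom_zero (iUpStar_iLoStar R)).
exact: hom_zero_iso (iso_refl _) (iso_sym (exact_shiftn _ _ _)).
Qed.

Lemma recollement_generation (X : C') (Y : C'') :
  (forall A, thick_closure X A) -> (forall B, thick_closure Y B) ->
  forall Z, thick_closure (iLoStar R X ⊞ jLoStar R Y) Z.
Proof.
move=> genX genY Z P thP PXY; have [d tri] := rec_triangle_star R Z.
apply: (thick_middle thP tri).
  exact: (genX _ _ (thick_preim (iLoStar R) thP) (thick_summand thP PXY)).
apply: (genY _ _ (thick_preim (jLoStar R) thP)).
(* [thick_summand] extracts left summands only, so the two are swapped first. *)
have [s iso_s] := biprodC (iLoStar R X) (jLoStar R Y).
exact: (thick_summand thP (thick_iso thP iso_s PXY)).
Qed.

End Recollement.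

(** [R] is a bare functor with no given compatibility with shifts. The shift is therefore moved to
    the first argument, where exactness of [L] lets it pass. *)
Lemma hom_zero_right_adjoint (C D : triangulated) (L : exact_functor C D)
    (R : functor D C) (adj : adjunction L R) (X : C) (Y : D) (n : int) :
  hom_zero X (R Y)⟦n⟧ <-> hom_zero (L X) Y⟦n⟧.
Proof.
rewrite !hom_zero_shiftn -(adjunction_hom_zero adj).
exact: hom_zero_iso (exact_shiftn _ _ _) (iso_refl _).
Qed.

(** With the shift moved to the first argument, the second is an honest biproduct and splits. *)
Lemma hom_zero_biprod_shiftn (C : triangulated) (X Y Z W : C) (n : int) :
  hom_zero (X ⊞ Y) (Z ⊞ W)⟦n⟧ <->
  (hom_zero X Z⟦n⟧ /\ hom_zero X W⟦n⟧) /\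
  (hom_zero Y Z⟦n⟧ /\ hom_zero Y W⟦n⟧).
Proof.
by rewrite hom_zero_biprodl !hom_zero_shiftn !hom_zero_biprodr.
Qed.

Theorem theoremA (C' C C'' : triangulated) (R : recollement C' C C'')
    (jSharp : functor C C'') (jSharp_adj : adjunction (jLoStar R) jSharp)
    (T' : C') (T'' : C'') (hT' : tilting T') (hT'' : tilting T'') :
  [<-> tilting (iLoStar R T' ⊞ jLoStar R T'');
       forall n : int, n <> 0 ->
         forall f : T'' ~> (jSharp (iLoStar R T'))⟦n⟧, f = 0;
       forall n : int, n <> 0 ->
         forall f : iUpStar R (jLoStar R T'') ~> T'⟦n⟧, f = 0].
Proof.
case: hT' hT'' => [ext' gen'] [ext'' gen'']; tfae.
- move=> [ext _] n n0.
  apply/(hom_zero_right_adjoint jSharp_adj).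
  (* The entry kept is $\mathrm{Hom}(j_*T'', i_*T'[n])$, through which (2) and (3) are also compared
     below. *)
  by have /hom_zero_biprod_shiftn[_ []] := ext n n0.
- move=> ext n n0; apply/hom_zero_iUpStar.
  exact/(hom_zero_right_adjoint jSharp_adj)/ext.
- move=> ext; split; last exact: recollement_generation.
  move=> n n0; apply/hom_zero_biprod_shiftn; do 2!split.
  + exact/exact_hom_zero/ext'/n0/iLoStar_ff.
  + exact: hom_zero_iLoStar_jLoStar.
  + exact/hom_zero_iUpStar/ext.
  + exact/exact_hom_zero/ext''/n0/jLoStar_ff.
Qed.
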